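(* For all integers $\ell, m \ge 8$, the coefficients $p_n(\ell,m)$ of the $q$-binomial coefficient satisfy the strict inequalities $$p_{1}(\ell,m) < p_2(\ell,m) < \cdots < p_{\lfloor \ell m/2\rfloor}(\ell,m) = p_{\lceil \ell m/2\rceil}(\ell,m) > \cdots > p_{\ell m-1}(\ell,m).$$
   Context: For nonnegative integers $\ell, m$, the $q$-binomial (Gaussian) coefficient is $$\binom{m+\ell}{m}_q = \frac{(q^{m+1}-1)\cdots(q^{m+\ell}-1)}{(q-1)\cdots(q^{\ell}-1)} = \sum_{n=0}^{\ell m} p_n(\ell,m)\, q^n,$$ so $p_n(\ell,m)$ is the number of partitions of $n$ whose Young diagram fits inside an $\ell\times m$ rectangle. *)

(* Defs.v *)
From mathcomp Require Import all_boot all_order all_algebra ring.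

Set Implicit Arguments.
Unset Strict Implicit.
Unset Printing Implicit Defensive.

Import Order.TTheory GRing.Theory Num.Theory.
Local Open Scope ring_scope.

Definition qbinom_num (l m : nat) : {poly int} :=
  \prod_(1 <= i < l.+1) ('X^(m + i) - 1).

Definition qbinom_den (l : nat) : {poly int} :=
  \prod_(1 <= i < l.+1) ('X^i - 1).

(* The Gaussian coefficient binom(m + l, m)_q, with 'X for q. The denominator
   is monic, so [%/] over int is genuine Euclidean division; that it leaves no
   remainder is [qbinomE] below. *)
Definition qbinom (l m : nat) : {poly int} := qbinom_num l m %/ qbinom_den l.

(* p_n(l, m), as an integer. *)
Definition pcoef (n l m : nat) : int := (qbinom l m)`_n.

Lemma qbinom_den_monic (l : nat) : qbinom_den l \is monic.
Proof.
rewrite /qbinom_den big_add1 /= big_mkord.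
by apply: monic_prod => i _; apply: monicXnsubC.
Qed.

Lemma qbinom_num0 (m : nat) : qbinom_num 0 m = 1.
Proof. by rewrite /qbinom_num big_geq. Qed.

Lemma qbinom_den0 : qbinom_den 0 = 1.
Proof. by rewrite /qbinom_den big_geq. Qed.

Lemma qbinom_numSr (l m : nat) :
  qbinom_num l.+1 m = qbinom_num l m * ('X^(m + l.+1) - 1).
Proof. by rewrite /qbinom_num big_nat_recr. Qed.

Lemma qbinom_numSl (l m : nat) :
  qbinom_num l.+1 m = ('X^(m.+1) - 1) * qbinom_num l m.+1.
Proof.
rewrite /qbinom_num big_nat_recl //= addn1; congr (_ * _).
by rewrite big_add1 big_add1 /=; apply: eq_bigr => i _; rewrite addnS addSn addnS.
Qed.

Lemma qbinom_denS (l : nat) : qbinom_den l.+1 = qbinom_den l * ('X^(l.+1) - 1).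
Proof. by rewrite /qbinom_den big_nat_recr. Qed.

Lemma qbinom_dvd (l m : nat) : exists G : {poly int}, qbinom_num l m = G * qbinom_den l.
Proof.
elim: l m => [|l IHl] m; first by exists 1; rewrite qbinom_num0 qbinom_den0 mulr1.
elim: m => [|m [G IHm]].
  by exists 1; rewrite mul1r.
have [H HE] := IHl m.+1.
exists (G + 'X^(m.+1) * H).
rewrite mulrDl -IHm qbinom_denS (qbinom_numSr l m.+1) (qbinom_numSl l m).
rewrite -(mulrA _ H) (mulrA H) -HE exprD.
by ring.
Qed.

Lemma qbinomE (l m : nat) : qbinom l m * qbinom_den l = qbinom_num l m.
Proof.
have [G GE] := qbinom_dvd l m.
by rewrite /qbinom GE Pdiv.IdomainMonic.mulpK ?qbinom_den_monic.
Qed.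

(* Main.v *)
(* The difference p_k(l, m) - p_(k-1)(l, m) counts covariants of the binary form
   of degree m. Let D = sum_i i a_(i-1) d/da_i act on rat[a_0, ..., a_m], and
   let W(l, k) be the span of the monomials of degree l and weight k, of
   dimension p_k(l, m). By sl2 theory D maps W(l, k) onto W(l, k-1) as soon as
   2(k-1) < lm, so p_(k-1) < p_k if and only if D kills some nonzero element of
   W(l, k). Since D is a derivation of an integral domain, such elements
   multiply: covariants of types (l1, k1) and (l2, k2) give one of type
   (l1 + l2, k1 + k2). Hence strict unimodality at (8, m) and (l, m) implies it
   at (l + 8, m), every k > 1 being the sum of an index for (8, m) and one for
   (l, m), both different from 1. With the symmetry in l and m, only the cases
   8 <= l, m < 16 are left, and these are computed. This is the semigroup
   argument of Pak and Panova, with covariants in place of Kronecker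
   coefficients. *)
Require Import Defs.
From Stdlib Require Import BinNat.
From HB Require Import structures.
From mathcomp Require Import all_boot all_order all_algebra ring zify.
From mathcomp Require Import mpoly.
Set Implicit Arguments.
Unset Strict Implicit.
Unset Printing Implicit Defensive.
Import Order.TTheory GRing.Theory Num.Theory.
Local Open Scope ring_scope.

(** * Symmetries and Pascal recurrence of the Gaussian coefficients *)

Lemma qbinom_den_neq0 l : qbinom_den l != 0.
Proof. exact/monic_neq0/qbinom_den_monic. Qed.

(** Both sides are the product of the ['X^i - 1] for i up to m + l. The right side is symmetric in l
    and m, which gives [qbinomC]. *)
Lemma qbinom_num_den l m : qbinom_num l m * qbinom_den m = qbinom_den (m + l).
Proof.
elim: l => [|l IHl]; first by rewrite qbinom_num0 mul1r addn0.
by rewrite qbinom_numSr mulrAC IHl addnS qbinom_denS.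
Qed.

Lemma qbinomC l m : qbinom l m = qbinom m l.
Proof.
apply: (mulIf (qbinom_den_neq0 l)); apply: (mulIf (qbinom_den_neq0 m)).
by rewrite [RHS]mulrAC !qbinomE !qbinom_num_den addnC.
Qed.

Lemma qbinom0l m : qbinom 0 m = 1.
Proof. by have := qbinomE 0 m; rewrite qbinom_den0 qbinom_num0 mulr1. Qed.

Lemma qbinomSS l m :
  qbinom l.+1 m.+1 = qbinom l.+1 m + 'X^(m.+1) * qbinom l m.+1.
Proof.
apply: (mulIf (qbinom_den_neq0 l.+1)); rewrite mulrDl !qbinomE qbinom_denS.
rewrite qbinom_numSr qbinom_numSl -!mulrA (mulrA (qbinom l _)) qbinomE exprD.
by ring.
Qed.

Lemma pcoefC n l m : pcoef n l m = pcoef n m l.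
Proof. by rewrite /pcoef qbinomC. Qed.

Lemma pcoef0l n m : pcoef n 0 m = (n == 0)%:R.
Proof. by rewrite /pcoef qbinom0l coef1. Qed.

Lemma pcoefSS n l m : pcoef n l.+1 m.+1 =
  pcoef n l.+1 m + (if (n < m.+1)%N then 0 else pcoef (n - m.+1) l m.+1).
Proof. by rewrite /pcoef qbinomSS coefD coefXnM. Qed.

Lemma pcoef_gt n l m : (l * m < n)%N -> pcoef n l m = 0.
Proof.
elim: l m n => [|l IHl] m n lt_lm; first by rewrite pcoef0l; case: n lt_lm.
elim: m n lt_lm => [|m IHm] n lt_lm; first by rewrite pcoefC pcoef0l; case: n lt_lm.
rewrite pcoefSS IHm; last by lia.
by case: ifP => // ge_nm; rewrite IHl ?addr0 //; lia.
Qed.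

Lemma pcoef_sym n l m : (n <= l * m)%N -> pcoef (l * m - n) l m = pcoef n l m.
Proof.
have [s] := ubnP (l + m); elim: s l m n => // s IHs [|l] [|m] n lt_s le_n.
- by move: le_n; rewrite leqn0 => /eqP->.
- by move: le_n; rewrite leqn0 => /eqP->.
- by move: le_n; rewrite muln0 leqn0 => /eqP->.
(* The two sides are expanded by the two forms of the Pascal recurrence, which differ by exchanging
   l and m; complementation then matches the terms crosswise. *)
rewrite [RHS]pcoefSS pcoefC pcoefSS ![pcoef _ m.+1 _]pcoefC [pcoef _ m l.+1]pcoefC addrC.
congr (_ + _).
  have [le_n'|lt_n] := leqP n (l.+1 * m).
    rewrite ifF; last by apply/negbTE; rewrite -leqNgt; lia.
    rewrite -(IHs l.+1 m n) //; last by lia.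
    by congr pcoef; lia.
  by rewrite (pcoef_gt lt_n) ifT //; lia.
case: ltnP => le_m; first by rewrite pcoef_gt //; lia.
rewrite -(IHs l m.+1 (n - m.+1)%N); [|lia|lia].
by congr pcoef; lia.
Qed.

(** * Derivations of a polynomial ring and their commutators *)

Section Derivation.

Variables (n : nat) (R : comNzRingType).
Implicit Types (c : 'I_n -> {mpoly R[n]}) (p q : {mpoly R[n]}).

Definition der c p := \sum_i c i * p^`M(i).

Lemma der_is_linear c : linear (der c).
Proof.
move=> a p q; rewrite /der scaler_sumr -big_split /=; apply: eq_bigr => i _.
by rewrite mderivD mderivZ mulrDr scalerAr.
Qed.

HB.instance Definition _ c :=
  GRing.isLinear.Build R {mpoly R[n]} {mpoly R[n]} _ (der c) (der_is_linear c).

Lemma derD c : {morph der c : p q / p + q}.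
Proof. exact: linearD. Qed.

Lemma derZ c a : {morph der c : p / a *: p}.
Proof. exact: linearZ. Qed.

Lemma der0 c : der c 0 = 0.
Proof. exact: linear0. Qed.

Lemma derM c p q : der c (p * q) = der c p * q + p * der c q.
Proof.
rewrite /der mulr_sumr mulr_suml -big_split /=; apply: eq_bigr => i _.
by rewrite mderivM mulrDr (mulrA _ (p^`M(i))) [in X in _ + X = _]mulrCA.
Qed.

Lemma derX c i : der c 'X_i = c i.
Proof.
rewrite /der (bigD1 i) //= big1 ?addr0 => [|j ne_ji].
  by rewrite mderivX mnm1E eqxx scale1r -{1}[U_(i)%MM]add0m addmK mpolyX0 mulr1.
by rewrite mderivX mnm1E eq_sym (negPf ne_ji) scale0r mulr0.
Qed.

Lemma derZX c a i : der c (a *: 'X_i) = a *: c i.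
Proof. by rewrite linearZ /= derX. Qed.

Lemma eq_der c c' : c =1 c' -> der c =1 der c'.
Proof. by move=> eq_c p; apply: eq_bigr => i _; rewrite eq_c. Qed.

(** The second-order parts of the two compositions agree because partial derivatives commute, so
    only a derivation remains. Operator identities thus reduce to checks on the variables. *)
Lemma der_comm c c' p : der c (der c' p) =
  der c' (der c p) + der (fun i => der c (c' i) - der c' (c i)) p.
Proof.
have derE d d' : der d (der d' p) =
    \sum_i der d (d' i) * p^`M(i) + \sum_i \sum_j d' i * d j * p^`M(i)^`M(j).
  rewrite {2}/der linear_sum -big_split /=; apply: eq_bigr => i _.
  rewrite derM; congr (_ + _); rewrite /der mulr_sumr; apply: eq_bigr => j _.
  by rewrite mulrA.
rewrite !derE [in RHS]exchange_big /= addrAC; congr (_ + _).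
  by rewrite -big_split /=; apply: eq_bigr => i _; rewrite mulrBl addrC subrK.
apply: eq_bigr => i _; apply: eq_bigr => j _.
by rewrite mderiv_comm (mulrC (c j)).
Qed.

Lemma mcoeff_der_diag (a : 'I_n -> R) p mu :
  (der (fun i => a i *: 'X_i) p)@_mu = (\sum_i a i *+ mu i) * p@_mu.
Proof.
elim/mpolyind: p => [|b nu p _ _ IHp]; first by rewrite linear0 mcoeff0 mulr0.
rewrite linearP /= !mcoeffD !mcoeffZ IHp mulrDr; congr (_ + _).
rewrite /der linear_sum /= mcoeffX mulrCA; congr (_ * _).
rewrite mulr_suml; apply: eq_bigr => i _.
rewrite mderivX -scalerAl mcoeffZ -scalerAr mcoeffZ -mpolyXD mcoeffX mulrA.
rewrite mulr_natr; case nui: (nu i) => [|k].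
  have [<-|_] := eqVneq nu mu; first by rewrite nui mulr0n !mul0r.
  by rewrite mulr0n mul0r mulr0.
rewrite addmC submK; last first.
  by apply/mnm_lepP => j; rewrite mnm1E; case: eqVneq => // <-; rewrite nui.
by have [<-|_] := eqVneq nu mu; rewrite ?nui // !mulr0.
Qed.

End Derivation.

(** * The sl2 action and its isobaric eigenspaces *)

Section Covariants.

Variable m : nat.
Local Notation n := m.+1.
Local Notation poly := {mpoly rat[n]}.
Implicit Types (p q w : poly) (mu : 'X_{1..n}).

(** The boundary indices are harmless: the factor i vanishes at i = 0, and in [raise_coef] the
    factor m - i kills the default value of [inord] at i = m. *)
Definition lower_coef (i : 'I_n) : poly := (i : nat)%:R *: 'X_(inord i.-1).
Definition raise_coef (i : 'I_n) : poly := (m - i)%:R *: 'X_(inord i.+1).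
Definition degree_coef (i : 'I_n) : poly := 1 *: 'X_i.
Definition weight_coef (i : 'I_n) : poly := (i : nat)%:R *: 'X_i.

Local Notation D := (der lower_coef).
Local Notation U := (der raise_coef).
Local Notation E := (der degree_coef).
Local Notation F := (der weight_coef).

Lemma degree_der (a : 'I_n -> rat) (f : 'I_n -> 'I_n) p :
  E (der (fun i => a i *: 'X_(f i)) p) = der (fun i => a i *: 'X_(f i)) (E p).
Proof.
rewrite der_comm [X in _ + X]big1 ?addr0 // => i _.
by rewrite /degree_coef !derZX !scale1r subrr mul0r.
Qed.

Lemma weight_lower p : F (D p) = D (F p) - D p.
Proof.
rewrite der_comm; congr (_ + _); rewrite -sumrN; apply: eq_bigr => i _.
rewrite -mulNr; congr (_ * _).
rewrite /lower_coef /weight_coef !derZX.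
rewrite !scalerA -scalerBl -scaleNr; congr (_ *: _).
case: i => [[|i] lt_i] /=; first by rewrite !mul0r oppr0 subr0.
by rewrite inordK 1?ltnW // -natr1; ring.
Qed.

Lemma weight_raise p : F (U p) = U (F p) + U p.
Proof.
rewrite der_comm; congr (_ + _); apply: eq_bigr => i _.
congr (_ * _); rewrite /raise_coef /weight_coef !derZX.
rewrite !scalerA -scalerBl; congr (_ *: _).
have [lt_im|ge_im] := ltnP i m; last first.
  by rewrite (eqP (_ : (m - i)%N == 0%N)) ?subn_eq0 // !(mul0r, mulr0) subr0.
by rewrite inordK // -natr1; ring.
Qed.

(** This is the sl2 relation [D, U] = H, where H = m E - 2 F acts on degree l and weight k as the
    scalar lm - 2k. *)
Lemma lower_raise p : D (U p) = U (D p) + (m%:R *: E p - 2 *: F p).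
Proof.
have -> : m%:R *: E p - 2 *: F p =
    der (fun i => m%:R *: degree_coef i - 2 *: weight_coef i) p.
  rewrite /der !scaler_sumr -sumrB; apply: eq_bigr => i _.
  by rewrite !scalerAl -mulrBl.
rewrite der_comm; congr (_ + _); apply: eq_der => i.
rewrite [in X in X - _]/raise_coef [in X in _ - X]/lower_coef !derZX.
rewrite /raise_coef /lower_coef.
have -> : (m - i)%:R *: ((inord i.+1 : 'I_n)%:R *: 'X_(inord (inord i.+1 : 'I_n).-1))
    = ((m%:R - i%:R) * i.+1%:R) *: 'X_i :> poly.
  have [lt_im|ge_im] := ltnP i m.
    by rewrite inordK //= inord_val scalerA natrB // ltnW.
  have eq_im : i = m :> nat by apply/eqP; rewrite eqn_leq ge_im -ltnS ltn_ord.
  by rewrite eq_im subnn subrr !mul0r !scale0r.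
have -> : (i : nat)%:R *: ((m - (inord i.-1 : 'I_n))%:R *:
      'X_(inord (inord i.-1 : 'I_n).+1)) = (i%:R * (m%:R - i%:R + 1)) *: 'X_i :> poly.
  case: i => [[|i] lt_i] /=; first by rewrite !mul0r !scale0r.
  rewrite inordK 1?ltnW //= scalerA natrB; last exact: ltnW.
  congr ((_ * _) *: 'X_ _); first by rewrite -natr1; ring.
  by apply: val_inj; rewrite /= inordK.
rewrite /degree_coef /weight_coef !scalerA -!scalerBl.
by congr (_ *: _); rewrite -natr1; ring.
Qed.

(** The eigenvalues are rational, so that a weight can become negative under lowering instead of
    being truncated. *)
Definition eigen (a b : rat) p := E p = a *: p /\ F p = b *: p.

Lemma eigenD a b p q : eigen a b p -> eigen a b q -> eigen a b (p + q).
Proof. by move=> [Ep Fp] [Eq Fq]; rewrite /eigen !derD Ep Eq Fp Fq !scalerDr. Qed.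

Lemma eigenZ a b c p : eigen a b p -> eigen a b (c *: p).
Proof.
move=> [Ep Fp]; rewrite /eigen !derZ Ep Fp.
by rewrite !scalerA mulrC [c * b]mulrC.
Qed.

Lemma eigenM a b a' b' p q :
  eigen a b p -> eigen a' b' q -> eigen (a + a') (b + b') (p * q).
Proof.
move=> [Ep Fp] [Eq Fq]; rewrite /eigen !derM Ep Eq Fp Fq.
by rewrite -!scalerAl -!scalerAr -!scalerDl.
Qed.

Lemma eigen_lower a b p : eigen a b p -> eigen a (b - 1) (D p).
Proof.
move=> [Ep Fp]; split; first by rewrite degree_der Ep derZ.
by rewrite weight_lower Fp derZ scalerBl scale1r.
Qed.

Lemma eigen_raise a b p : eigen a b p -> eigen a (b + 1) (U p).
Proof.
move=> [Ep Fp]; split; first by rewrite degree_der Ep derZ.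
by rewrite weight_raise Fp derZ scalerDl scale1r.
Qed.

Lemma eigen_iter_lower a b p j : eigen a b p -> eigen a (b - j%:R) (iter j D p).
Proof.
move=> ep; elim: j => [|j IHj] /=; first by rewrite subr0.
by rewrite -natr1 opprD addrA; apply: eigen_lower.
Qed.

(** Moving U leftwards past j + 1 copies of D produces the scalars m a - 2 (b - i) for i = 0, ...,
    j; the factor is their sum. *)
Lemma iter_lower_raise a b p j : eigen a b p ->
  iter j.+1 D (U p) = U (iter j.+1 D p) +
    (j.+1%:R * (m%:R * a - 2 * b + j%:R)) *: iter j D p.
Proof.
move=> ep; elim: j => [|j IHj].
  rewrite /= lower_raise ep.1 ep.2 !scalerA -scalerBl.
  by congr (_ + _ *: _); ring.
rewrite iterS IHj derD derZ [in LHS]/= lower_raise.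
have [Ei Fi] := eigen_iter_lower j.+1 ep.
rewrite Ei Fi !scalerA -scalerBl -addrA -scalerDl.
by congr (_ + _ *: _); rewrite -!natr1; ring.
Qed.

(* With c the scalar of [iter_lower_raise], the vector w - c^-1 D U w is killed
   by one power of D less than w, whence the induction on j. *)
Lemma lower_surj a b w j : eigen a b w -> iter j D w = 0 -> 0 < m%:R * a - 2 * b ->
  exists2 u, eigen a (b + 1) u & D u = w.
Proof.
move=> + + h_gt0; elim: j w => [|j IHj] w ew /= Djw.
  exists 0; last by rewrite der0 -Djw.
  by split; rewrite der0 scaler0.
pose c := j.+1%:R * (m%:R * a - 2 * b + j%:R).
have c_neq0 : c != 0.
  by rewrite mulf_neq0 ?pnatr_eq0 // gt_eqF // ltr_wpDr.
have itB k x y : iter k D (x - y) = iter k D x - iter k D y.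
  by elim: k => //= k ->; rewrite linearB.
have itZ k d x : iter k D (d *: x) = d *: iter k D x.
  by elim: k => //= k ->; rewrite derZ.
have eDUw : eigen a b (D (U w)).
  by have := eigen_lower (eigen_raise ew); rewrite addrK.
have ew' : eigen a b (w - c^-1 *: D (U w)).
  by rewrite -scaleNr; apply: eigenD => //; apply: eigenZ.
have [|u' eu' Du'] := IHj _ ew'.
  rewrite itB itZ -iterSr (iter_lower_raise _ ew) /= Djw der0 add0r.
  by rewrite scalerA mulVf // scale1r subrr.
exists (u' + c^-1 *: U w); first by apply/eigenD/eigenZ/eigen_raise.
by rewrite derD derZ Du' subrK.
Qed.

(** * Weights and enumeration of monomials *)

Definition wt mu := (\sum_(i < n) mu i * i)%N.

Definition isobaric (l k : nat) := eigen l%:R k%:R.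

Lemma eigen_supp a b p mu : eigen a b p -> p@_mu != 0 ->
  (mdeg mu)%:R = a /\ (wt mu)%:R = b.
Proof.
move=> [Ep Fp] nz_mu; split; apply: (mulIf nz_mu).
  rewrite -[RHS]mcoeffZ -Ep mcoeff_der_diag mdegE natr_sum.
  by congr (_ * _); apply: eq_bigr => i _.
rewrite -[RHS]mcoeffZ -Fp mcoeff_der_diag natr_sum.
by congr (_ * _); apply: eq_bigr => i _; rewrite -mulrnA mulnC.
Qed.

Lemma isobaric_supp l k p mu : isobaric l k p -> p@_mu != 0 ->
  mdeg mu = l /\ wt mu = k.
Proof.
by move=> ip /(eigen_supp ip)[/eqP + /eqP]; rewrite !eqr_nat => /eqP-> /eqP->.
Qed.

Lemma isobaricX mu : isobaric (mdeg mu) (wt mu) 'X_[mu].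
Proof.
split; apply/mpolyP => nu; rewrite mcoeffZ mcoeff_der_diag mcoeffX.
  have [<-|_] := eqVneq mu nu; last by rewrite !mulr0.
  by rewrite mdegE natr_sum.
have [<-|_] := eqVneq mu nu; last by rewrite !mulr0.
rewrite natr_sum; congr (_ * _); apply: eq_bigr => i _.
by rewrite -mulrnA mulnC.
Qed.

Lemma isobaric_lower l k p : isobaric l k.+1 p -> isobaric l k (D p).
Proof. by move/eigen_lower; rewrite -natr1 addrK. Qed.

(** [D p] would have weight -1, and no monomial has negative weight. *)
Lemma lower_isobaric0 l p : isobaric l 0 p -> D p = 0.
Proof.
move/eigen_lower => eD; apply/mpolyP => mu; rewrite mcoeff0; apply/eqP.
apply/negPn/negP => /(eigen_supp eD)[_ wt_mu].
by have := ler0n rat (wt mu); rewrite wt_mu sub0r oppr_ge0 ler10.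
Qed.

Lemma isobaric_iter_lower0 l k p : isobaric l k p -> iter k.+1 D p = 0.
Proof.
elim: k p => [|k IHk] p ip; first exact: lower_isobaric0 ip.
by rewrite iterSr; apply/IHk/isobaric_lower.
Qed.

Lemma isobaric_lower_surj l k w : isobaric l k w -> (k.*2 < l * m)%N ->
  exists2 u, isobaric l k.+1 u & D u = w.
Proof.
move=> iw lt_k; have [|u eu <-] := lower_surj iw (isobaric_iter_lower0 iw).
  by rewrite -!natrM subr_gt0 ltr_nat mul2n mulnC.
by exists u; rewrite // /isobaric -natr1.
Qed.

(* The monomials of degree l in a_0, ..., a_(r-1): either a_(r-1) does not occur,
   or it can be divided out. This mirrors [pcoefSS]. *)
Fixpoint mons (r : nat) : nat -> seq 'X_{1..n} :=
  if r is r'.+1 then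
    fix monsr (l : nat) :=
      if l is l'.+1 then
        mons r' l ++ [seq (mu + U_(inord r'))%MM | mu <- monsr l']
      else [:: 0%MM]
  else fun l => if l is 0 then [:: 0%MM] else [::].

Lemma mons0 r : mons r 0 = [:: 0%MM].
Proof. by case: r. Qed.

Lemma monsS r l : mons r.+1 l.+1 =
  mons r l.+1 ++ [seq (mu + U_(inord r))%MM | mu <- mons r.+1 l].
Proof. by []. Qed.

Lemma mem_mons r l mu : (r <= n)%N ->
  reflect (mdeg mu = l /\ forall i : 'I_n, (r <= i)%N -> mu i = 0%N) (mu \in mons r l).
Proof.
elim: r l mu => [|r IHr] l mu le_rn.
  case: l => [|l] /=.
    rewrite inE; apply: (iffP eqP) => [->|[/eqP + _]]; last by rewrite mdeg_eq0 => /eqP.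
    by split=> [|i _]; rewrite ?mdeg0 ?mnm0E.
  constructor => -[dmu mu0]; suff: mdeg mu = 0%N by rewrite dmu.
  by apply/eqP; rewrite mdeg_eq0; apply/eqP/mnmP => i; rewrite mu0 ?mnm0E.
elim: l mu => [|l IHl] mu.
  rewrite mons0 inE; apply: (iffP eqP) => [->|[/eqP + _]]; last by rewrite mdeg_eq0 => /eqP.
  by split=> [|i _]; rewrite ?mdeg0 ?mnm0E.
have rK : (inord r : 'I_n) = r :> nat by rewrite inordK.
rewrite monsS mem_cat; apply: (iffP orP).
  move=> [/(IHr _ _ (ltnW le_rn))[-> mu0]|/mapP[nu /IHl[dnu nu0] ->]].
    by split=> // i /ltnW/mu0.
  split=> [|i lt_ri]; first by rewrite mdegD mdeg1 dnu addn1.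
  rewrite mnmDE mnm1E nu0 // (_ : _ == i = false) //.
  by apply/eqP => /(congr1 val) /= eq_i; rewrite -eq_i rK ltnn in lt_ri.
move=> [dmu mu0]; have [mur0|mur_neq0] := eqVneq (mu (inord r)) 0%N.
  left; apply/(IHr _ _ (ltnW le_rn)); split=> // i; rewrite leq_eqVlt.
  case/orP => [/eqP eq_ri|]; last exact: mu0.
  by rewrite -mur0; congr (mu _); apply: val_inj; rewrite /= rK.
have muE : (mu - U_(inord r) + U_(inord r))%MM = mu.
  by apply: submK; apply/mnm_lepP => i; rewrite mnm1E; case: eqP => // <-; rewrite lt0n.
right; apply/mapP; exists (mu - U_(inord r))%MM; last by rewrite muE.
apply/IHl; split=> [|i /mu0]; last by rewrite mnmBE => ->.
by apply/eqP; rewrite -eqSS -dmu -{2}muE mdegD mdeg1 addn1.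
Qed.

Lemma uniq_mons r l : (r <= n)%N -> uniq (mons r l).
Proof.
elim: r l => [|r IHr] l le_rn; first by case: l.
elim: l => [|l IHl]; first by rewrite mons0.
rewrite monsS cat_uniq IHr 1?ltnW // map_inj_uniq ?IHl ?andbT; last exact: addIm.
apply/hasPn => _ /mapP[nu _ ->].
apply/negP => /(mem_mons _ _ (ltnW le_rn))[_ /(_ (inord r))].
by rewrite inordK // leqnn mnmDE mnm1E eqxx addn1 => /(_ isT).
Qed.

Lemma wtU mu r : (r <= m)%N -> wt (mu + U_(inord r))%MM = (wt mu + r)%N.
Proof.
move=> le_rm; rewrite /wt; under eq_bigr do rewrite mnmDE mulnDl.
rewrite big_split /=; congr (_ + _)%N; rewrite (bigD1 (inord r)) //= big1 => [|i ne_ir].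
  by rewrite mnm1E eqxx mul1n inordK // addn0.
by rewrite mnm1E eq_sym (negPf ne_ir).
Qed.

Lemma wt0 : wt 0%MM = 0%N.
Proof. by rewrite /wt big1 // => i _; rewrite mnm0E. Qed.

(** Dividing by a_r lowers the degree by one and the weight by r, as in [pcoefSS]. The exponent of
    a_i is the number of parts i in a partition of k into l parts of size at most r, zero parts
    allowed. *)
Lemma count_mons l r k : (r <= m)%N ->
  (count (fun mu => wt mu == k) (mons r.+1 l))%:R = pcoef k l r.
Proof.
elim: l r k => [|l IHl] r k le_rm; first by rewrite mons0 /= wt0 addn0 pcoef0l eq_sym.
elim: r le_rm k => [|r IHr] le_rm k.
  rewrite monsS /= count_map (eq_count (a2 := fun mu => wt mu == k)).
    by rewrite IHl // !(pcoefC k _ 0) !pcoef0l.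
  by move=> mu /=; rewrite wtU // addn0.
rewrite monsS count_cat natrD IHr 1?ltnW // pcoefSS; congr (_ + _).
rewrite count_map; case: ltnP => [lt_kr|le_rk].
  rewrite (eq_count (a2 := pred0)) ?count_pred0 // => mu /=.
  by rewrite wtU //; apply/eqP => eq_k; rewrite -eq_k ltnNge leq_addl in lt_kr.
rewrite -IHl //; congr (_ %:R); apply: eq_count => mu /=.
by rewrite wtU // -{1}(subnK le_rk) eqn_add2r.
Qed.

Definition basis l k := [seq mu <- mons n l | wt mu == k].

Lemma size_basis l k : (size (basis l k))%:R = pcoef k l m.
Proof. by rewrite size_filter count_mons. Qed.

Lemma mem_basis l k mu : (mu \in basis l k) = (mdeg mu == l) && (wt mu == k).
Proof.
rewrite mem_filter andbC; congr (_ && _).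
apply/(mem_mons _ _ (leqnn _))/eqP => [[]//|dmu]; split=> // i.
by rewrite leqNgt ltn_ord.
Qed.

Lemma uniq_basis l k : uniq (basis l k).
Proof. exact/filter_uniq/uniq_mons. Qed.

(** * Linear algebra of the lowering operator *)

Definition of_coord (s : seq 'X_{1..n}) (v : 'rV[rat]_(size s)) : poly :=
  \sum_(i < size s) v 0 i *: 'X_[tnth (in_tuple s) i].

Definition coord (s : seq 'X_{1..n}) p : 'rV[rat]_(size s) :=
  \row_i p@_(tnth (in_tuple s) i).

Lemma of_coord_is_linear s : linear (@of_coord s).
Proof.
move=> a u v; rewrite /of_coord scaler_sumr -big_split /=; apply: eq_bigr => i _.
by rewrite !mxE scalerDl scalerA.
Qed.

HB.instance Definition _ s :=
  GRing.isLinear.Build rat 'rV[rat]_(size s) poly _ (@of_coord s) (@of_coord_is_linear s).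

Lemma coord_is_linear s : linear (coord s).
Proof. by move=> a p q; apply/rowP => i; rewrite !mxE mcoeffD mcoeffZ. Qed.

HB.instance Definition _ s :=
  GRing.isLinear.Build rat poly 'rV[rat]_(size s) _ (coord s) (@coord_is_linear s).

Lemma of_coordK s : uniq s -> cancel (@of_coord s) (coord s).
Proof.
move=> uniq_s v; apply/rowP => i; rewrite mxE linear_sum (bigD1 i) //= big1 => [|j ne_ji].
  by rewrite mcoeffZ mcoeffX eqxx mulr1 addr0.
rewrite mcoeffZ mcoeffX !(tnth_nth 0%MM) nth_uniq ?ltn_ord //.
by rewrite (_ : (_ == _) = false) ?mulr0 //; apply: negbTE.
Qed.

Lemma coordK l k p : isobaric l k p -> of_coord (coord (basis l k) p) = p.
Proof.
move=> ip; rewrite /of_coord; set s := basis l k.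
have -> : \sum_(i < size s) coord s p 0 i *: 'X_[tnth (in_tuple s) i] =
    \sum_(mu <- s) p@_mu *: 'X_[mu].
  by rewrite [RHS]big_tnth; apply: eq_bigr => i _; rewrite mxE.
apply/mpolyP => mu; rewrite linear_sum /=.
under eq_bigr do rewrite mcoeffZ mcoeffX.
have [mu_s|mu_s] := boolP (mu \in s).
  rewrite (bigD1_seq mu) ?uniq_basis //= eqxx mulr1 big1 ?addr0 // => nu ne_nu.
  by rewrite (negPf ne_nu) mulr0.
rewrite big_seq big1 => [|nu nu_s]; last first.
  by case: eqP => [eq_nu|_]; rewrite ?mulr0 // -eq_nu nu_s in mu_s *.
apply/esym/eqP/negPn/negP => /(isobaric_supp ip)[dmu wmu].
by rewrite mem_basis dmu wmu !eqxx in mu_s.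
Qed.

Lemma isobaric_of_coord l k v : isobaric l k (@of_coord (basis l k) v).
Proof.
rewrite /of_coord; elim/big_ind: _ => [|p q|i _]; first by split; rewrite der0 scaler0.
  exact: eigenD.
apply: eigenZ; move: (tnth _ _) (mem_tnth i (in_tuple (basis l k))) => mu.
by rewrite mem_basis => /andP[/eqP <- /eqP <-]; apply: isobaricX.
Qed.

Definition lower_mx l k : 'M[rat]_(size (basis l k.+1), size (basis l k)) :=
  lin1_mx (coord (basis l k) \o D \o @of_coord (basis l k.+1)).

Lemma mul_lower_mx l k v :
  v *m lower_mx l k = coord (basis l k) (D (of_coord v)).
Proof. by rewrite mul_rV_lin1. Qed.

(** Such p are the seminvariants, the leading coefficients of covariants. *)
Definition covariant l k := exists p, [/\ p != 0, isobaric l k p & D p = 0].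

(** The lowering matrix acts on row vectors and has more rows than columns, hence a nonzero
    kernel. *)
Lemma covariant_exists l k : pcoef k l m < pcoef k.+1 l m -> covariant l k.+1.
Proof.
rewrite -!size_basis ltr_nat => lt_size.
have: kermx (lower_mx l k) != 0.
  rewrite -mxrank_eq0 mxrank_ker -lt0n subn_gt0.
  exact: leq_ltn_trans (rank_leq_col _) lt_size.
case/rowV0Pn => v /sub_kermxP vM0 v_neq0; exists (of_coord v); split.
- by apply: contra_neq v_neq0 => v0; rewrite -[v]of_coordK ?uniq_basis // v0 linear0.
- exact: isobaric_of_coord.
rewrite -[LHS](@coordK l k) -?mul_lower_mx ?vM0 ?linear0 //.
exact/isobaric_lower/isobaric_of_coord.
Qed.

(** Surjectivity of D makes the rank equal to the number of columns; a nonzero kernel vector keeps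
    it below the number of rows. *)
Lemma covariant_pcoef_lt l k :
  covariant l k.+1 -> (k.*2 < l * m)%N -> pcoef k l m < pcoef k.+1 l m.
Proof.
move=> [p [p_neq0 ip Dp0]] lt_k; rewrite -!size_basis ltr_nat.
have <- : \rank (lower_mx l k) = size (basis l k).
  apply/eqP; rewrite -[_ == _]/(row_full _) -sub1mx; apply/row_subP => i.
  have [u iu Du] := isobaric_lower_surj (isobaric_of_coord (row i 1%:M)) lt_k.
  apply/submxP; exists (coord (basis l k.+1) u).
  by rewrite mul_lower_mx coordK // Du of_coordK ?uniq_basis.
rewrite ltn_neqAle rank_leq_row andbT.
apply: contra_neq p_neq0 => /eqP free_M.
rewrite -(coordK ip) -[coord _ p]mulmx1.
have : coord (basis l k.+1) p *m lower_mx l k = 0.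
  by rewrite mul_lower_mx coordK // Dp0 linear0.
rewrite mulmx1; move/eqP; rewrite mulmx_free_eq0 // => /eqP ->.
exact: linear0.
Qed.

Lemma covariantM l1 l2 k1 k2 :
  covariant l1 k1 -> covariant l2 k2 -> covariant (l1 + l2) (k1 + k2).
Proof.
move=> [p [p0 ip Dp]] [q [q0 iq Dq]]; exists (p * q); split.
- exact: mulf_neq0.
- by rewrite /isobaric !natrD; apply: eigenM.
by rewrite derM Dp Dq mul0r mulr0 addr0.
Qed.

(** The witness is a power of a_0, which D kills because its weight is 0. *)
Lemma covariant0 l : covariant l 0.
Proof.
exists 'X_[U_(ord0) *+ l].
have iX : isobaric l 0 'X_[U_(ord0) *+ l].
  have := isobaricX (U_(ord0) *+ l); rewrite mdegMn mdeg1 mul1n.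
  suff -> : wt (U_(ord0) *+ l)%MM = 0%N by [].
  rewrite /wt big1 // => i _; rewrite mulmnE mnm1E.
  by case: eqP => [<-|_]; rewrite ?mul0n ?muln0.
split=> //; last exact: lower_isobaric0 iX.
by rewrite -msupp_eq0 msuppX.
Qed.

End Covariants.

(** * Strict unimodality and its additivity *)

Definition strictly_unimodal l m :=
  forall k, (1 <= k)%N -> (k < (l * m)./2)%N -> pcoef k l m < pcoef k.+1 l m.

Lemma strictly_unimodalC l m : strictly_unimodal l m -> strictly_unimodal m l.
Proof. by move=> suP k; rewrite mulnC ![pcoef _ m l]pcoefC; apply: suP. Qed.

(** An index k >= 2 uses the strict step from k - 1 to k; [strictly_unimodal] says nothing about the
    step from 0 to 1. *)
Lemma strictly_unimodal_covariant l m k :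
  strictly_unimodal l m -> (k <= (l * m)./2)%N -> k != 1%N -> covariant m l k.
Proof.
case: k => [|[|k]] // suP le_k _; first exact: covariant0.
exact/covariant_exists/suP.
Qed.

(** Since l1 m is even, the halves add exactly, so each index up to the middle splits into two
    admissible ones; the bounds 6 leave room to avoid the index 1. *)
Lemma strictly_unimodalD l1 l2 m : (6 <= (l1 * m)./2)%N -> (6 <= (l2 * m)./2)%N ->
  ~~ odd (l1 * m) -> strictly_unimodal l1 m -> strictly_unimodal l2 m ->
  strictly_unimodal (l1 + l2) m.
Proof.
move=> ge1 ge2 even1 su1 su2 k k_gt0 lt_k.
have half_add : ((l1 + l2) * m)./2 = ((l1 * m)./2 + (l2 * m)./2)%N.
  by rewrite mulnDl halfD (negPf even1).
apply: covariant_pcoef_lt; last by lia.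
have split_k k1 k2 : k.+1 = (k1 + k2)%N -> (k1 <= (l1 * m)./2)%N ->
    (k2 <= (l2 * m)./2)%N -> k1 != 1%N -> k2 != 1%N -> covariant m (l1 + l2) k.+1.
  move=> -> le1 le2 k1n1 k2n1.
  by apply: covariantM; apply: strictly_unimodal_covariant.
have [le_k|gt_k] := leqP k.+1 (l2 * m)./2; first by apply: (split_k 0%N k.+1); lia.
(* Filling the second index completely would leave 1 for the first, so one unit is moved over. *)
have [eq_k|ne_k] := eqVneq k (l2 * m)./2.
  by apply: (split_k 2%N (l2 * m)./2.-1); lia.
by apply: (split_k (k.+1 - (l2 * m)./2)%N (l2 * m)./2); lia.
Qed.

(** * Certified computation of the small cases *)

Fixpoint addl (s t : seq N) : seq N :=
  match s, t with
  | x :: s', y :: t' => N.add x y :: addl s' t'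
  | [::], _ => t
  | _, [::] => s
  end.

Lemma nth_addl s t k : nth 0%num (addl s t) k = N.add (nth 0%num s k) (nth 0%num t k).
Proof.
elim: s t k => [|x s IHs] [|y t] [|k] //=.
- by rewrite N.add_0_r.
- by rewrite N.add_0_r.
Qed.

(* Given the coefficient lists [prev] of qbinom l i, qbinom l i.+1, ... and
   [acc] of qbinom l.+1 i.-1 (empty when i = 0), returns those of qbinom l.+1 i,
   qbinom l.+1 i.+1, ... *)
Fixpoint gauss_row (i : nat) (acc : seq N) (prev : seq (seq N)) : seq (seq N) :=
  if prev is g :: prev' then
    let h := addl acc (nseq i 0%num ++ g) in h :: gauss_row i.+1 h prev'
  else [::].

(** The initial row is qbinom 0 m = 1 for all m < sz; each round raises l by one. *)
Definition gauss_table (sz l : nat) : seq (seq N) :=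
  iter l (gauss_row 0 [::]) (nseq sz [:: 1%num]).

Definition represents (g : seq N) (l m : nat) :=
  forall k, (nat_of_bin (nth 0%num g k))%:R = pcoef k l m.

(** This is the Pascal recurrence: prepending m + 1 zeros multiplies by q^(m+1). *)
Lemma represents_step acc g l m :
  represents acc l.+1 m -> represents g l m.+1 ->
  represents (addl acc (nseq m.+1 0%num ++ g)) l.+1 m.+1.
Proof.
move=> acc_rep g_rep k; rewrite nth_addl pcoefSS -acc_rep.
rewrite (_ : nat_of_bin (N.add _ _) = nat_of_bin (nth 0%num acc k) +
  nat_of_bin (nth 0%num (nseq m.+1 0%num ++ g) k))%N; last by lia.
rewrite natrD nth_cat size_nseq nth_nseq; congr (_ + _).
by case: ltnP => // _; rewrite g_rep.
Qed.

Lemma gauss_row_represents l i acc prev : represents acc l.+1 i ->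
  (forall j, (j < size prev)%N -> represents (nth [::] prev j) l (i.+1 + j)) ->
  forall j, (j < size prev)%N ->
    represents (nth [::] (gauss_row i.+1 acc prev) j) l.+1 (i.+1 + j).
Proof.
elim: prev i acc => // g prev IHprev i acc acc_rep prev_rep.
have step : represents (addl acc (nseq i.+1 0%num ++ g)) l.+1 i.+1.
  by apply: represents_step; rewrite // -[X in represents _ _ X]addn0; apply: (prev_rep 0%N).
case=> [|j] lt_j; first by rewrite addn0.
rewrite -addSnnS; apply: IHprev => // j' lt_j'.
by rewrite addSnnS; apply: (prev_rep j'.+1).
Qed.

Lemma size_gauss_row i acc prev : size (gauss_row i acc prev) = size prev.
Proof. by elim: prev i acc => //= g prev IHprev i acc; rewrite IHprev. Qed.

Lemma size_gauss_table sz l : size (gauss_table sz l) = sz.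
Proof. by elim: l => [|l IHl] /=; rewrite ?size_nseq ?size_gauss_row. Qed.

Lemma represents1 m : represents [:: 1%num] 0 m.
Proof. by move=> k; rewrite pcoef0l nth_seq1; case: k. Qed.

Lemma gauss_tableP sz l m :
  (m < sz)%N -> represents (nth [::] (gauss_table sz l) m) l m.
Proof.
elim: l m => [|l IHl] m lt_m; first by rewrite nth_nseq lt_m; apply: represents1.
rewrite /gauss_table iterS -/(gauss_table sz l).
have := size_gauss_table sz l; case: (gauss_table sz l) IHl => [|g prev] /= IHl sz_prev.
  by rewrite -sz_prev in lt_m.
(* In column 0 the accumulator is empty and no zeros are prepended, so g is copied; this is right
   because qbinom l 0 = 1 for every l. *)
have g_rep : represents g l.+1 0.
  move=> k; rewrite (IHl 0%N (leq_ltn_trans (leq0n _) lt_m) k).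
  by rewrite !(pcoefC k _ 0) !pcoef0l.
case: m lt_m => [|m] lt_m //=.
apply: (@gauss_row_represents l 0) => //; last by rewrite -ltnS sz_prev.
by move=> j lt_j; apply: (IHl j.+1); rewrite -sz_prev ltnS.
Qed.

Definition increasing_on (g : seq N) (a b : nat) :=
  all (fun k => N.ltb (nth 0%num g k) (nth 0%num g k.+1)) (iota a (b - a)).

Lemma strictly_unimodal_base l m : (8 <= l < 16)%N -> (8 <= m < 16)%N ->
  strictly_unimodal l m.
Proof.
move=> l_range m_range k k_gt0 lt_k.
have : all (fun l' => let row := gauss_table 16 l' in
    all (fun m' => increasing_on (nth [::] row m') 1 (l' * m')./2) (iota 8 8)) (iota 8 8).
  by vm_compute.
have l_in : l \in iota 8 8 by rewrite mem_iota.
have m_in : m \in iota 8 8 by rewrite mem_iota.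
move=> /allP/(_ l l_in)/allP/(_ m m_in)/allP/(_ k).
rewrite mem_iota subnKC; last by lia.
rewrite k_gt0 lt_k => /(_ isT) lt_N.
case/andP: m_range => _ lt_m.
rewrite -!(gauss_tableP _ lt_m) ltr_nat.
by move: lt_N; move: (nth _ _ k) (nth _ _ k.+1) => x y /N.ltb_lt; lia.
Qed.

(** * Extension to all l and m at least 8 *)

Lemma strictly_unimodal_ge8 l m : (8 <= l)%N -> (8 <= m)%N -> strictly_unimodal l m.
Proof.
have extend m' : (8 <= m')%N -> (forall l', (8 <= l' < 16)%N -> strictly_unimodal l' m') ->
    forall l', (8 <= l')%N -> strictly_unimodal l' m'.
  move=> m'_ge8 base l'; elim/ltn_ind: l' => l' IHl' l'_ge8.
  have [lt_l'|ge_l'] := ltnP l' 16; first by apply: base; rewrite l'_ge8.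
  (* From l' >= 16, removing 8 leaves at least 8, and 8 m' is even as additivity requires. *)
  rewrite -(subnKC l'_ge8); apply: strictly_unimodalD; last by apply: IHl'; lia.
  - by lia.
  - by have : (8 * m' <= (l' - 8) * m')%N; [rewrite leq_mul2r | ]; lia.
  - by rewrite oddM.
  - exact: base.
(* The extension is done in l, then after exchanging the sides in m, which leaves the computed
   range. *)
move=> l_ge8 m_ge8; apply: (extend) => // l' l'_range.
apply: strictly_unimodalC; apply: extend => // [|m' m'_range]; first by lia.
exact: strictly_unimodal_base.
Qed.

Theorem theorem1 (l m : nat) (hl : (8 <= l)%N) (hm : (8 <= m)%N) :
  (forall n : nat, (1 <= n)%N -> (n < (l * m)./2)%N ->
     (pcoef n l m < pcoef n.+1 l m)%R) /\
  pcoef (l * m)./2 l m = pcoef (uphalf (l * m)) l m /\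
  (forall n : nat, (uphalf (l * m) <= n)%N -> (n < l * m - 1)%N ->
     (pcoef n.+1 l m < pcoef n l m)%R).
Proof.
have incr := strictly_unimodal_ge8 hl hm.
split; first exact: incr.
split=> [|n ge_n lt_n].
  by rewrite -pcoef_sym; [congr pcoef | ]; lia.
(* Reflection in the middle carries the falling half to the rising one; n < lm - 1 keeps the smaller
   reflected index at least 1. *)
rewrite -(pcoef_sym (n := n.+1)) -?(pcoef_sym (n := n)); [|lia|lia].
have -> : (l * m - n = (l * m - n.+1).+1)%N by lia.
by apply: incr; lia.
Qed.
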